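(* Fix positive reals $A$ and $\varepsilon$. For a positive integer $t$ and a prime power $q$, let $N_t(q)$ denote the number of elements $a\in\mathbb{F}_q$ such that the binomial $X^t-a\in\mathbb{F}_q[X]$ is irreducible over $\mathbb{F}_q$. Then for every sufficiently large prime power $q$ and sufficiently large real $T$ with $$T\ge \big(\log(q-1)\big)^{(1+\varepsilon)A\log_3 q/\log_4 q}$$ we have $$\sum_{t\le T}N_t(q)\le (q-1)\,T/(\log T)^A,$$ where the sum is over positive integers $t\le T$.
   Context: Convention: $\log x=\max\{\ln x,2\}$, where $\ln$ is the natural logarithm, and for an integer $k\ge2$, $\log_k x=\log(\log_{k-1}x)$ (with $\log_1=\log$). *)

(* Defs.v *)
From HB Require Import structures.
From mathcomp Require Import all_boot all_order all_algebra.
From mathcomp Require Import all_classical all_reals all_analysis.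
From mathcomp Require Import qpoly.
Set Implicit Arguments.
Unset Strict Implicit.
Unset Printing Implicit Defensive.
Import Order.TTheory GRing.Theory Num.Theory.
Local Open Scope ring_scope.

Definition tlog (R : realType) (x : R) : R := Num.max (ln x) 2%:R.

Definition tlog_iter (R : realType) (k : nat) (x : R) : R := iter k (@tlog R) x.

Definition prime_power (q : nat) : Prop :=
  exists p k : nat, [/\ prime p, (0 < k)%N & q = (p ^ k)%N].

(* This depends only on #|F|, since finite fields of equal cardinality are
   isomorphic: it is N_t(q) for q = #|F|. *)
Definition num_irr_binomials (F : finFieldType) (t : nat) : nat :=
  #|[set a : F | irreducibleb ('X^t - a%:P)]|.

(* Main.v *)
(* If l is a prime divisor of t and l does not divide q - 1, every a is an l-th
   power b ^ l, and X^(t/l) - b divides X^t - a.  So the sum is at most q times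
   the number of t <= T all of whose prime factors divide N = q - 1.  These are
   counted by Rankin's trick: apart from t <= T / M with M = 4 (ln T)^A, their
   number is at most (M / T)^eta times the sum over all t <= T of s(t)^eta,
   where s(t) is the largest divisor of t composed of primes dividing N.  Summing
   over all t, rather than over those t with s(t) = t only, saves a factor of
   order ln ln q: the sum is at most T exp(sum_(p | N) O((p^eta - 1) / p)), and
   with y = ln N the exponent is O(y^eta (eta ln y + 1)), by Chebyshev's
   estimate for p <= y and by the bound O(y) on the number of p | N for p > y.
   One takes y^eta = (ln ln ln q)^kappa with a kappa < 1 depending on eps. *)
Require Import Defs.
From mathcomp Require Import all_boot all_order all_algebra.
From mathcomp Require Import all_classical all_reals all_analysis.
From mathcomp Require Import finfield qpoly ring lra.
Set Implicit Arguments.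
Unset Strict Implicit.
Unset Printing Implicit Defensive.
Import Order.TTheory GRing.Theory Num.Theory.
Local Open Scope ring_scope.

(** * Irreducible binomials and the primes dividing [#|F| - 1] *)

(** The exponent 1 + v (#|F| - 1), rather than v (#|F| - 1), lets the identity cover a = 0. *)
Lemma expf_card_pred (F : finFieldType) (a : F) (v : nat) :
  a ^+ (v * #|F|.-1).+1 = a.
Proof.
elim: v => [|v IH]; first by rewrite mul0n expr1.
rewrite mulSn -addnS exprD IH -exprSr prednK ?expf_card //.
by apply/card_gt0P; exists a.
Qed.

(** Bezout gives u l = v (#|F| - 1) + 1, so a ^ u is an l-th root of a. *)
Lemma ex_root_coprime (F : finFieldType) (l : nat) (a : F) :
  (0 < l)%N -> coprime l #|F|.-1 -> exists b, b ^+ l = a.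
Proof.
move=> l0 /eqP co; case: (egcdnP #|F|.-1 l0) => u v e _.
exists (a ^+ u); rewrite -exprM e co addn1; exact: expf_card_pred.
Qed.

Lemma irr_binomial_pi (F : finFieldType) (t : nat) (a : F) :
  (0 < t)%N -> irreducibleb ('X^t - a%:P) -> (\pi(#|F|.-1)).-nat t.
Proof.
move=> t0 /irreducibleP [_ irr].
have F2 : (0 < #|F|.-1)%N by rewrite -subn1 subn_gt0 finNzRing_gt1.
apply/pnatP => // l pl lt.
apply: contraT => nl.
have co : coprime l #|F|.-1.
  rewrite prime_coprime //; apply: contra nl => dl.
  by rewrite mem_primes pl F2.
have [b bl] := ex_root_coprime a (prime_gt0 pl) co.
move: lt t0 irr; case/dvdnP => s -> ; rewrite muln_gt0 => /andP [s0 _] irr.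
have sz m (c : F) : (0 < m)%N -> size ('X^m - c%:P) = m.+1.
  exact: size_XnsubC.
have dv : 'X^s - b%:P %| 'X^(s * l) - a%:P.
  by rewrite -bl exprM polyC_exp subrXX dvdp_mulr.
(* The divisor has positive degree s, so irreducibility makes it an associate of X^(s l) - a; then s
   = s l, which contradicts l > 1. *)
have := irr ('X^s - b%:P); rewrite sz // eqSS -lt0n => /(_ s0 dv).
move/eqp_size; rewrite !sz ?muln_gt0 ?s0 ?prime_gt0 // => -[] e.
by move: (prime_gt1 pl); rewrite -(ltn_pmul2l s0) muln1 -e ltnn.
Qed.

Lemma num_irr_binomials_le (F : finFieldType) (t : nat) : (0 < t)%N ->
  (num_irr_binomials F t <= #|F| * (\pi(#|F|.-1)).-nat t)%N.
Proof.
move=> t0; rewrite /num_irr_binomials.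
have [ti|ti] := boolP (_.-nat t); first by rewrite muln1 max_card.
rewrite muln0 leqn0 cards_eq0; apply/eqP/setP => a; rewrite !inE.
by apply: contraNF ti; exact: irr_binomial_pi.
Qed.

(** * Sums of multiplicative weights over [t <= n] *)

Lemma sum_dvdn (V : nmodType) (f : nat -> V) (p n : nat) : (0 < p)%N ->
  \sum_(1 <= t < n.+1 | (p %| t)%N) f t = \sum_(1 <= j < (n %/ p).+1) f (p * j)%N.
Proof.
move=> p0; elim: n => [|n IH]; first by rewrite div0n !big_geq.
rewrite big_mkcond big_nat_recr //= -big_mkcond IH divnS //.
have [d|_] := boolP (_ %| _)%N; last by rewrite addr0.
rewrite add1n [RHS]big_nat_recr //=; congr (_ + f _).
by rewrite -[LHS](divnK d) divnS // d add1n mulnC.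
Qed.

Section WeightedSum.
Variable R : realFieldType.

(* Writing D n for the sum of (w ^ v_p(t) - 1) h(t), only multiples of p
   contribute, whence D n = w D(n/p) + (w - 1) sum_(t <= n/p) h(t).  Bounding
   w ^ v_p(t) itself recursively would only give the larger factor
   1 / (1 - w / p), which is too weak below. *)
Lemma sum_weight_prime (p : nat) (w C : R) (h : nat -> R) :
  prime p -> 1 <= w < p%:R -> 0 <= C ->
  (forall t, (0 < t)%N -> h (p * t)%N = h t) ->
  (forall n, \sum_(1 <= t < n.+1) h t <= C * n%:R) ->
  forall n, \sum_(1 <= t < n.+1) w ^+ logn p t * h t
    <= C * (1 + (w - 1) / (p%:R - w)) * n%:R.
Proof.
move=> pp /andP [w1 wp] C0 hp hC n.
pose D n := \sum_(1 <= t < n.+1) (w ^+ logn p t - 1) * h t.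
have p0 : 0 < p%:R :> R by rewrite ltr0n prime_gt0.
have pw : 0 < p%:R - w by rewrite subr_gt0.
have w10 : 0 <= w - 1 by rewrite subr_ge0.
have w0 : 0 <= w by exact: le_trans w1.
have DE m : D m = w * D (m %/ p)%N + (w - 1) * \sum_(1 <= t < (m %/ p).+1) h t.
  rewrite /D (bigID (fun t => p %| t)%N) /= [X in _ + X]big1_seq ?addr0; last first.
    move=> t /andP [pt]; rewrite mem_index_iota => /andP [t0 _].
    by rewrite lognE (negPf pt) !andbF expr0 subrr mul0r.
  rewrite sum_dvdn ?prime_gt0 // !mulr_sumr -big_split /=.
  apply: eq_big_nat => j /andP [j0 _].
  rewrite hp // lognM ?(prime_gt0 pp) // logn_prime // eqxx exprS; ring.
have Dle m : D m <= C * ((w - 1) / (p%:R - w)) * m%:R.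
  elim/ltn_ind: m => m IH; case: m IH => [|m] IH.
    by rewrite /D big_geq // mulr0.
  set m1 := m.+1; rewrite DE.
  have mp : (m1 %/ p)%N%:R <= m1%:R / p%:R :> R.
    by rewrite ler_pdivlMr // -natrM ler_nat leq_divM.
  have IH1 := IH _ (ltn_Pdiv (prime_gt1 pp) (ltn0Sn m)).
  have K0 : 0 <= C * ((w - 1) / (p%:R - w)) by rewrite mulr_ge0 // divr_ge0 // ltW.
  have -> : C * ((w - 1) / (p%:R - w)) * m1%:R =
    w * (C * ((w - 1) / (p%:R - w)) * (m1%:R / p%:R)) + (w - 1) * (C * (m1%:R / p%:R)).
    by field; rewrite !gt_eqF.
  apply: lerD; apply: ler_wpM2l => //.
    by apply: le_trans IH1 _; exact: ler_wpM2l.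
  by apply: le_trans (hC _) _; exact: ler_wpM2l.
rewrite [leLHS](_ : _ = D n + \sum_(1 <= t < n.+1) h t).
  by apply: le_trans (lerD (Dle n) (hC n)) _; rewrite mulrDr mulr1 [leRHS]mulrDl addrC.
by rewrite /D -big_split /=; apply: eq_bigr => t _; rewrite mulrBl mul1r subrK.
Qed.

(** The primes are peeled off one at a time: multiplying t by p leaves the weights at the other
    primes unchanged, so the remaining product can serve as h. *)
Lemma sum_weight_primes (w : nat -> R) (s : seq nat) :
  uniq s -> (forall p, p \in s -> prime p && (1 <= w p < p%:R)) ->
  forall n, \sum_(1 <= t < n.+1) \prod_(p <- s) w p ^+ logn p t
    <= n%:R * \prod_(p <- s) (1 + (w p - 1) / (p%:R - w p)).
Proof.
elim: s => [|p s IH] /=.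
  move=> _ _ n; rewrite big_nil mulr1 (eq_bigr (fun=> 1)) => [|t _]; last by rewrite big_nil.
  by rewrite big_const_nat iter_addr_0 subn1.
move=> /andP [ps us] hs n; have /andP [pp wp] := hs p (mem_head _ _).
have hs' r : r \in s -> prime r && (1 <= w r < r%:R).
  by move=> rs; apply: hs; rewrite in_cons rs orbT.
under eq_bigr do rewrite big_cons.
rewrite big_cons mulrC [X in X * _]mulrC.
apply: sum_weight_prime => //.
- rewrite big_seq; apply: prodr_ge0 => r /hs' /andP [_ /andP [w1 wr]].
  by rewrite addr_ge0 // divr_ge0 ?subr_ge0 // ltW.
- move=> t t0; apply: eq_big_seq => r rs.
  rewrite lognM ?(prime_gt0 pp) // logn_prime //.
  by have [e|_] := eqVneq r p; [rewrite -e rs in ps | rewrite add0n].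
- by move=> m; rewrite mulrC; exact: IH.
Qed.

End WeightedSum.

(** * Elementary bounds for primes *)

Lemma fact_le_expn n : (n`! <= n ^ n)%N.
Proof.
elim: n => // n IH; rewrite factS expnS leq_mul2l /=.
by apply: leq_trans IH _; case: n => // n; rewrite leq_exp2r.
Qed.

(** Only the first term n %/ p of Legendre's formula for the exponent of p in n! is kept. *)
Lemma prod_prime_expn_le_fact n :
  (\prod_(1 <= p < n.+1 | prime p) p ^ (n %/ p) <= n`!)%N.
Proof.
have -> : n`! = (\prod_(1 <= p < n`!.+1) p ^ logn p n`!)%N.
  by rewrite -[LHS](partnT (fact_gt0 n)) /partn big_ltn_cond //= expn0 mul1n.
rewrite [leqRHS](@big_cat_nat _ _ _ n.+1) ?ltnS ?fact_geq //=.
rewrite -[leqLHS]muln1; apply: leq_mul; last first.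
  by rewrite big_nat_cond prodn_cond_gt0 // => i /andP [/andP [i0 _] _]; rewrite expn_gt0 (leq_trans _ i0).
rewrite big_mkcond /= big_nat_cond [leqRHS]big_nat_cond; apply: leq_prod => p /andP [/andP [p0 pn] _].
case: ifP => [pp|_]; last by rewrite expn_gt0 p0.
rewrite leq_exp2l ?prime_gt1 // logn_fact // big_ltn ?(leq_trans _ pn) // expn1.
exact: leq_addr.
Qed.

Section RealEstimates.
Variable R : realType.

(** A Mertens-type upper bound: take logarithms of prod p ^ (n %/ p) <= n ^ n. Replacing n %/ p by n
    / p costs the factor 2, since n %/ p >= 1 for p <= n. *)
Lemma sum_ln_prime_div_le (n : nat) : (0 < n)%N ->
  \sum_(1 <= p < n.+1 | prime p) ln (p%:R : R) / p%:R <= 2 * ln n%:R.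
Proof.
move=> n0; have n0R : 0 < n%:R :> R by rewrite ltr0n.
rewrite -(ler_pM2l n0R) mulr_sumr.
have : \sum_(1 <= p < n.+1 | prime p) ln (p%:R : R) *+ (n %/ p) <= n%:R * ln n%:R.
  rewrite -ler_expR expR_sum [leRHS]expRM_natl lnK ?posrE //.
  rewrite (eq_bigr (fun p => (p ^ (n %/ p))%N%:R)) => [|p pp]; last first.
    by rewrite -[ln _ *+ _]mulr_natl expRM_natl lnK ?natrX // posrE ltr0n prime_gt0.
  rewrite -natr_prod -natrX ler_nat.
  exact: leq_trans (prod_prime_expn_le_fact n) (fact_le_expn n).
move=> H; rewrite mulrCA; apply: le_trans (ler_wpM2l _ H) => //.
rewrite mulr_sumr big_nat_cond [leRHS]big_nat_cond.
apply: ler_sum => p /andP [/andP [p1 pn] pp].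
have p0R : 0 < p%:R :> R by rewrite ltr0n.
have k1 : (0 < n %/ p)%N by rewrite divn_gt0 // -ltnS.
have : (n <= 2 * (n %/ p) * p)%N.
  apply: leq_trans (ltnW (ltn_ceil n p1)) _; rewrite leq_mul2r; apply/orP; right.
  by rewrite mul2n -addnn -[leqLHS]addn1 leq_add2l.
rewrite -(ler_nat R) !natrM -ler_pdivrMr // => kn.
rewrite -[ln _ *+ _]mulr_natl [leRHS]mulrA.
rewrite [leLHS](_ : _ = n%:R / p%:R * ln p%:R); last by field; rewrite gt_eqF.
by rewrite ler_wpM2r // ln_ge0 // ler1n.
Qed.

Lemma expn_size_primes_le (N : nat) : (0 < N)%N -> (2 ^ size (primes N) <= N)%N.
Proof.
move=> N0; rewrite [leqRHS]prod_prime_decomp // prime_decompE big_map /=.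
rewrite -(count_predT (primes N)) -iter_muln_1 -big_const_seq.
rewrite big_seq [leqRHS]big_seq; apply: leq_prod => p.
rewrite mem_primes => /and3P [pp _ pN]; apply: leq_trans (prime_gt1 pp) _.
by rewrite -[leqLHS]expn1 leq_exp2l ?prime_gt1 // logn_gt0 mem_primes pp N0.
Qed.

Lemma size_primes_le_ln (N : nat) : (0 < N)%N ->
  (size (primes N))%:R <= 2 * ln (N%:R : R).
Proof.
move=> N0; have N0R : 0 < N%:R :> R by rewrite ltr0n.
have : ln ((2 ^ size (primes N))%N%:R : R) <= ln N%:R.
  by rewrite ler_ln ?posrE ?ltr0n ?expn_gt0 // ler_nat expn_size_primes_le.
(* From exp(-1/2) >= 1 - 1/2. *)
have ln2 : (2^-1 : R) <= ln 2.
  rewrite -ler_expR lnK ?posrE //.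
  have := expR_ge1Dx (- 2^-1 : R); rewrite expRN => h.
  rewrite -(invrK (expR _)) -[leRHS]invrK lef_pV2 ?posrE ?invr_gt0 ?expR_gt0 //.
  by apply: le_trans h; lra.
rewrite natrX lnXn // -[ln _ *+ _]mulr_natl => h.
have := ler_wpM2l (ler0n R (size (primes N))) ln2; lra.
Qed.

Lemma ler_sum_filter (s : seq nat) (m : nat) (f : nat -> R) :
  uniq s -> all prime s -> (forall p, 0 <= f p) ->
  \sum_(p <- s | (p <= m)%N) f p <= \sum_(1 <= p < m.+1 | prime p) f p.
Proof.
move=> us /allP ps f0.
rewrite [leRHS](bigID (mem s)) /= -[leLHS]addr0; apply: lerD; last exact: sumr_ge0.
rewrite -big_filter -[leRHS]big_filter le_eqVlt; apply/orP; left; apply/eqP.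
apply: perm_big; apply: uniq_perm; rewrite ?filter_uniq ?iota_uniq // => p.
rewrite !mem_filter mem_index_iota ltnS.
have [/ps pp|_] := boolP (p \in s); last by rewrite !andbF.
by rewrite pp prime_gt0 // !andbT.
Qed.

(** * The exponent of the Euler product *)

(** The denominator is at least p / 4. For p <= y the numerator is at most eta ln p y^eta; for p > y
    the decrease of x^(eta - 1) is used. The last term is uniform in p, so that it can be multiplied
    by the number of primes. *)
Lemma prime_power_excess_le (p : nat) (eta y : R) :
  prime p -> 0 < eta <= 2^-1 -> 0 < y ->
  (p%:R `^ eta - 1) / (p%:R - p%:R `^ eta) <=
    (if p%:R <= y then 4 * eta * y `^ eta * (ln p%:R / p%:R) else 0)
    + 4 * y `^ eta / y.
Proof.
move=> pp /andP [e0 e2] y0.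
have p2 : 2 <= p%:R :> R by rewrite (ler_nat _ 2) prime_gt1.
set P : R := p%:R in p2 *.
have P0 : 0 < P by lra.
have lnP : 0 <= ln P by rewrite ln_ge0; lra.
have w1 : 1 <= P `^ eta by rewrite -(powRr0 P) ler_powR; lra.
have w0 : 0 < P `^ eta by lra.
(* Here eta <= 1/2, and sqrt P <= 3 P / 4 as P >= 2 > 16/9. *)
have wle : P `^ eta <= 3 / 4 * P.
  apply: (@le_trans _ _ (P `^ 2^-1)); first by rewrite ler_powR; lra.
  have s2 : (P `^ 2^-1) ^+ 2 = P.
    by rewrite -powR_mulrn ?powR_ge0 // -powRrM mulVf ?powRr1 // ltW.
  have s0 := powR_ge0 P 2^-1.
  by rewrite -ler_sqr ?nnegrE ?mulr_ge0 ?(ltW P0) // s2; nra.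
have step1 : (P `^ eta - 1) / (P - P `^ eta) <= 4 * (P `^ eta - 1) / P.
  rewrite ler_pdivrMr; last lra.
  rewrite mulrAC ler_pdivlMr //; nra.
apply: le_trans step1 _.
have y1 : 0 <= y `^ eta by exact: powR_ge0.
case: ifP => [Py|/negbT].
  (* This is 1 + x <= exp x at x = - eta ln P, multiplied by P^eta. *)
  have le1 : P `^ eta - 1 <= eta * ln P * P `^ eta.
    have := expR_ge1Dx (- (eta * ln P)).
    rewrite -ln_powR expRN lnK ?posrE // => h.
    have := ler_wpM2r (ltW w0) h; rewrite mulVf ?gt_eqF // ; lra.
  have le2 : P `^ eta <= y `^ eta by rewrite ge0_ler_powR ?nnegrE //; lra.
  have le3 : P `^ eta - 1 <= eta * ln P * y `^ eta.
    by apply: le_trans le1 _; rewrite ler_wpM2l // mulr_ge0 // ltW.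
  rewrite -[leLHS]addr0; apply: lerD; last by rewrite divr_ge0 ?mulr_ge0 // ltW.
  by rewrite mulrA ler_wpM2r ?invr_ge0 ?(ltW P0) //; lra.
rewrite -ltNge add0r => yP.
have le4 : P `^ eta / P <= y `^ eta / y.
  have -> : P `^ eta / P = P `^ (eta - 1).
    by rewrite powRB ?(gt_eqF P0) ?implybT // powRr1 // ltW.
  have -> : y `^ eta / y = y `^ (eta - 1).
    by rewrite powRB ?(gt_eqF y0) ?implybT // powRr1 // ltW.
  have -> : eta - 1 = - (1 - eta) by lra.
  rewrite !powRN lef_pV2 ?posrE ?powR_gt0 //.
  by rewrite ge0_ler_powR ?nnegrE //; lra.
rewrite -!mulrA ler_pM2l //; apply: le_trans le4.
by rewrite ler_wpM2r ?invr_ge0 ?(ltW P0) //; lra.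
Qed.

(** With y = ln N, the primes up to y contribute 8 eta y^eta ln y by the Mertens-type bound, and the
    uniform term 4 y^eta / y is incurred at most 2 y times. *)
Lemma euler_factor_sum_le (N : nat) (eta : R) :
  0 < eta <= 2^-1 -> 1 <= ln (N%:R : R) ->
  \sum_(p <- primes N) (p%:R `^ eta - 1) / (p%:R - p%:R `^ eta)
  <= 8 * (ln N%:R) `^ eta * (eta * ln (ln N%:R) + 1).
Proof.
move=> eh y1; set y := ln _; have y0 : 0 < y by exact: lt_le_trans y1.
have N0 : (0 < N)%N.
  by case: N y1 @y y0 => // ; rewrite ln0 // ler10.
have /andP [e0 _] := eh.
have Y0 : 0 <= y `^ eta by exact: powR_ge0.
apply: (@le_trans _ _ (\sum_(p <- primes N)
    ((if p%:R <= y then 4 * eta * y `^ eta * (ln p%:R / p%:R) else 0) + 4 * y `^ eta / y))).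
  rewrite big_seq [leRHS]big_seq; apply: ler_sum => p.
  by rewrite mem_primes => /and3P [pp _ _]; exact: prime_power_excess_le.
rewrite big_split /= -big_mkcond /= big_const_seq iter_addr_0 count_predT.
have S1 : (4 * y `^ eta / y) *+ size (primes N) <= 8 * y `^ eta.
  rewrite -mulr_natr; have := ler_wpM2l _ (size_primes_le_ln N0) => /(_ (4 * y `^ eta / y)).
  rewrite divr_ge0 ?mulr_ge0 ?(ltW y0) // => /(_ isT) h; apply: le_trans h _.
  by rewrite -/y le_eqVlt; apply/orP; left; apply/eqP; field; rewrite gt_eqF.
have m0 : (0 < Num.truncn y)%N by rewrite truncn_gt0.
have S2 : \sum_(p <- primes N | p%:R <= y) 4 * eta * y `^ eta * (ln p%:R / p%:R)
    <= 8 * y `^ eta * (eta * ln y).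
  rewrite -mulr_sumr (eq_bigl (fun p => p <= Num.truncn y)%N); last first.
    by move=> p; rewrite truncn_ge_nat // ltW.
  have := ler_sum_filter (f := fun p => ln p%:R / p%:R) (Num.truncn y) (primes_uniq N).
  move=> /(_ (introT allP _)) h.
  have {}h : \sum_(p <- primes N | (p <= Num.truncn y)%N) ln p%:R / p%:R <= 2 * ln y.
    apply: le_trans (h _ _) _.
    - by move=> p; rewrite mem_primes => /and3P [].
    - move=> [|p]; first by rewrite invr0 mulr0.
      by rewrite divr_ge0 // ln_ge0 // ler1n.
    apply: le_trans (sum_ln_prime_div_le m0) _.
    by rewrite ler_pM2l // ler_ln ?posrE ?ltr0n // truncn_le ltW.
  have := ler_wpM2l _ h => /(_ (4 * eta * y `^ eta)).
  rewrite !mulr_ge0 ?(ltW e0) // => /(_ isT) h2; apply: le_trans h2 _.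
  by rewrite le_eqVlt; apply/orP; left; apply/eqP; ring.
by rewrite mulrDr mulr1; exact: lerD.
Qed.

(** * Rankin's bound for integers composed of primes dividing [N] *)

Lemma sum_leq_real_le (z : R) (n : nat) : 0 <= z ->
  \sum_(1 <= t < n.+1) (t%:R <= z)%R%:R <= z.
Proof.
move=> z0; elim: n => [|n IH]; first by rewrite big_geq.
have [nz|zn] := leP n.+1%:R z; last by rewrite big_nat_recr //= (lt_geF zn) addr0.
apply: le_trans nz.
have -> : n.+1%:R = \sum_(1 <= t < n.+2) (1 : R) by rewrite sumr_const_nat subSS subn0.
by apply: ler_sum => t _; rewrite lern1 leq_b1.
Qed.

(** Identifies t^eta, for such t, with a weight that is defined for every t and to which
    [sum_weight_primes] applies. *)
Lemma powR_pnat (N t : nat) (eta : R) : (0 < N)%N -> (0 < t)%N ->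
  (\pi(N)).-nat t ->
  t%:R `^ eta = \prod_(p <- primes N) (p%:R `^ eta) ^+ logn p t.
Proof.
move=> N0 t0 st.
have {1}-> : t = (\prod_(p <- primes N) p ^ logn p t)%N.
  rewrite [LHS]prod_prime_decomp // prime_decompE big_map /=.
  rewrite [RHS](bigID (mem (primes t))) /= [X in (_ * X)%N]big1 => [|p]; last first.
    by rewrite -logn_gt0 lt0n negbK => /eqP ->.
  rewrite muln1 -[RHS]big_filter; apply: perm_big; apply: uniq_perm.
  - exact: primes_uniq.
  - by rewrite filter_uniq // primes_uniq.
  move=> p; rewrite mem_filter; case: (boolP (p \in primes t)) => //= pt.
  by have := pnatPpi st pt; rewrite inE /= => ->.
rewrite (big_morph (fun n : nat => n%:R `^ eta) (id1 := 1) (op1 := *%R)); first last.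
- by rewrite powR1.
- by move=> a b; rewrite natrM powRM.
apply: eq_bigr => p _; move: (logn p t) => k.
by rewrite natrX -(powR_mulrn k (ler0n R p)) powRAC powR_mulrn // powR_ge0.
Qed.

Lemma smooth_count_le (N : nat) (eta T M : R) :
  0 < eta <= 2^-1 -> 1 <= ln (N%:R : R) -> 0 < T -> 0 < M ->
  \sum_(1 <= t < (Num.truncn T).+1) ((\pi(N)).-nat t)%:R
  <= T / M + (M / T) `^ eta *
     (T * expR (8 * (ln N%:R) `^ eta * (eta * ln (ln N%:R) + 1))).
Proof.
move=> eh y1 T0 M0; have /andP [e0 e2] := eh.
have N0 : (0 < N)%N by case: N y1 => //; rewrite ln0 // ler10.
pose f t : R := \prod_(p <- primes N) (p%:R `^ eta) ^+ logn p t.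
have f0 t : 0 <= f t by apply: prodr_ge0 => p _; rewrite exprn_ge0 // powR_ge0.
have MT : 0 < M / T by rewrite divr_gt0.
(* Each counted t either is at most T / M or satisfies (M t / T)^eta >= 1. *)
apply: (@le_trans _ _ (\sum_(1 <= t < (Num.truncn T).+1)
  ((t%:R <= T / M)%R%:R + (M / T) `^ eta * f t))).
  apply: ler_sum_nat => t /andP [t0 _].
  have mf : 0 <= (M / T) `^ eta * f t by rewrite mulr_ge0 // powR_ge0.
  have [st|_] := boolP (_.-nat t); last by rewrite addr_ge0.
  have [tM|Mt] := leP t%:R (T / M); first by rewrite lerDl.
  rewrite add0r /f -powR_pnat // -powRM ?(ltW MT) //.
  rewrite -[leLHS](powRr0 (M / T * t%:R)) ler_powR ?(ltW e0) //.
  move: Mt; rewrite ltr_pdivrMr // => Mt.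
  by rewrite mulrAC ler_pdivlMr // mul1r mulrC ltW.
rewrite big_split /=; apply: lerD; first by rewrite sum_leq_real_le // divr_ge0 // ltW.
rewrite -mulr_sumr ler_wpM2l ?powR_ge0 //.
have wp p : p \in primes N -> prime p && (1 <= (p%:R : R) `^ eta < p%:R).
  rewrite mem_primes => /and3P [pp _ _]; rewrite pp /=.
  have p1 : 1 < p%:R :> R by rewrite ltr1n prime_gt1.
  rewrite -[leLHS](powRr0 p%:R) ler_powR ?(ltW p1) ?(ltW e0) //=.
  rewrite -[ltRHS](powRr1 (ler0n R p)) /powR gt_eqF ?(lt_trans _ p1) //.
  by rewrite ltr_expR ltr_pM2r ?ln_gt0 //; lra.
apply: le_trans (sum_weight_primes (primes_uniq N) wp _) _.
apply: ler_pM => //.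
- rewrite big_seq; apply: prodr_ge0 => p /wp /andP [_ /andP [w1 wr]].
  by rewrite addr_ge0 // divr_ge0 ?subr_ge0 // ltW.
- by rewrite truncn_le ltW.
(* Apply 1 + x <= exp x to each Euler factor. *)
apply: (@le_trans _ _ (expR (\sum_(p <- primes N) (p%:R `^ eta - 1) / (p%:R - p%:R `^ eta)))).
  rewrite expR_sum big_seq [leRHS]big_seq; apply: ler_prod => p /wp /andP [_ /andP [w1 wr]].
  by rewrite expR_ge1Dx addr_ge0 // divr_ge0 ?subr_ge0 // ltW.
by rewrite ler_expR euler_factor_sum_le.
Qed.

(** * Choice of Rankin's exponent *)

Lemma expR_ge_sqr (x : R) : 0 <= x -> x ^+ 2 / 4 <= expR x.
Proof.
move=> x0; have -> : x = x / 2 + x / 2 by lra.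
rewrite expRD; have := expR_ge1Dx (x / 2); nra.
Qed.

Lemma expR_ge_cube (x : R) : 0 <= x -> x ^+ 3 / 27 <= expR x.
Proof.
move=> x0; have -> : expR x = expR (x / 3) ^+ 3.
  by rewrite -expRM_natl; congr expR; lra.
have -> : x ^+ 3 / 27 = (x / 3) ^+ 3 by field.
by rewrite lerXn2r ?nnegrE ?expR_ge0 //; [lra|have := expR_ge1Dx (x / 3); lra].
Qed.

(* The variables are W = ln ln ln ln q, so that exp W = ln ln ln q, with
   X = ln ln (q - 1) and tau = ln T; eta is Rankin's exponent, chosen so that
   ln (q - 1) ^ eta = (ln ln ln q) ^ kappa with kappa < 1. *)
Lemma rankin_saving (A eps : R) : 0 < A -> 0 < eps ->
  exists W0 : R, 2 <= W0 /\ forall W X tau : R, W0 <= W ->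
    expR (expR W) / 2 <= X <= expR (expR W) ->
    (1 + eps) * A * expR W / W * X <= tau ->
    exists eta : R, 0 < eta <= 2^-1 /\
      (1 + eta) * (ln 4 + A * ln tau) + 8 * expR (eta * X) * (eta * X + 1)
      <= eta * tau.
Proof.
move=> A0 e0.
(* Chosen so that kappa (1 + eps) = 1 + eps / 2 exceeds 1, while lam = 1 - kappa > 0 keeps W
   exp(kappa W) of smaller order than exp W. *)
pose kappa : R := (2 + eps) / (2 + 2 * eps).
pose lam : R := eps / (2 + 2 * eps).
have d0 : 0 < 2 + 2 * eps by lra.
have kl : kappa = 1 - lam by rewrite /kappa /lam; field; rewrite gt_eqF.
have l0 : 0 < lam by rewrite divr_gt0.
have lh : lam <= 2^-1 by rewrite ler_pdivrMr //; lra.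
have ke : kappa * (1 + eps) = 1 + eps / 2.
  by rewrite /kappa; field; rewrite gt_eqF //; lra.
have [k0 k1] : 2^-1 <= kappa /\ kappa <= 1 by split; lra.
move: kappa lam kl l0 lh ke k0 k1 => kappa lam kl l0 lh ke k0 k1.
(* All lower-order terms together will be at most C (1 + W) exp(kappa W). [D] is such that W >= D
   gives eps A lam^2 W^2 / 8 >= 2 C W. *)
pose C : R := 2 * A ^+ 2 * (1 + eps) + 2 * A + 16.
have A20 : 0 < A ^+ 2 by rewrite exprn_gt0.
have C0 : 0 < C by rewrite /C; nra.
pose D : R := 16 * C / (eps * A * lam ^+ 2).
have l20 : 0 < lam ^+ 2 by rewrite exprn_gt0.
have eAl : 0 < eps * A * lam ^+ 2 by rewrite !mulr_gt0.
have D0 : 0 < D by rewrite divr_gt0 // mulr_gt0.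
exists (60 + 4 * A + D); split; first by lra.
move=> W X tau hW /andP [X1 X2] ht.
have W0 : 60 <= W by lra.
pose Z := expR W; rewrite -/Z in X1 X2 ht.
have ZW : 1 + W <= Z by exact: expR_ge1Dx.
have Z0 : 0 < Z by lra.
(* Since Z > 54, the cubic bound suffices. It gives X >= Z^2 >= Z W, whence eta Z <= 1. *)
have eZ : 2 * Z ^+ 2 <= expR Z.
  have h := @expR_ge_cube Z (ltW Z0); apply: le_trans h.
  have Z2 : 0 < Z ^+ 2 by rewrite exprn_gt0.
  rewrite exprS; nra.
have X0 : 0 < X by apply: lt_le_trans X1; rewrite divr_gt0 ?expR_gt0.
have Xb : Z * W <= X by nra.
pose eta := kappa * W / X.
have eX : eta * X = kappa * W by rewrite /eta; field; rewrite gt_eqF.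
have e1 : 0 < eta by rewrite divr_gt0 // mulr_gt0 //; lra.
have eZ1 : eta * Z <= 1.
  by rewrite /eta mulrAC ler_pdivrMr //; nra.
have e2 : eta <= 2^-1 by nra.
exists eta; rewrite e1 e2; split => //.
rewrite eX.
pose u := tau / X.
have tu : tau = u * X by rewrite /u; field; rewrite gt_eqF.
have u0 : (1 + eps) * A * Z / W <= u by rewrite ler_pdivlMr.
have W1 : 0 < W by lra.
have u0' : 0 < (1 + eps) * A * Z / W by rewrite divr_gt0 // !mulr_gt0 //; lra.
have upos : 0 < u by exact: lt_le_trans u0.
have -> : eta * tau = kappa * W * u by rewrite tu mulrCA eX mulrC.
(* Split tau = (u / Z) Z X and use ln x < x on the first factor only: its coefficient 1 / Z lets
   kappa W u absorb it. *)
have lnt : ln tau <= u / Z + W + Z.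
  rewrite tu lnM ?posrE //; apply: lerD; last first.
    by rewrite -(expRK Z) ler_ln ?posrE ?expR_gt0.
  have uZ : 0 < u / Z by rewrite divr_gt0.
  have {1}-> : u = u / Z * Z by field; rewrite gt_eqF.
  rewrite lnM ?posrE // [ln Z]expRK lerD2r.
  exact/ltW/ln_sublinear.
have ln4 : ln (4 : R) <= 4 by apply/ltW/ln_sublinear.
have ln40 : 0 <= ln (4 : R) by rewrite ln_ge0 //; lra.
pose v := u / Z.
have uv : u = v * Z by rewrite /v; field; rewrite gt_eqF.
have v0 : 0 < v by rewrite divr_gt0.
rewrite -/v in lnt.
(* Everything that is o(Z), absorbed by the slack eps / 2 in the leading term. *)
have main : eps * A / 2 * Z >= 2 * A ^+ 2 * (1 + eps) + A + 2 * A * W + 8 + 8 * expR (kappa * W) * (W + 1).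
  have Ze : Z = expR (kappa * W) * expR (lam * W).
    by rewrite -expRD /Z; congr expR; rewrite kl; ring.
  have E1 : 1 <= expR (kappa * W) by rewrite -expR0 ler_expR; nra.
  have E2 : (lam * W) ^+ 2 / 4 <= expR (lam * W) by apply: expR_ge_sqr; nra.
  have E3 : C * (1 + W) <= eps * A / 2 * expR (lam * W).
    apply: (@le_trans _ _ (eps * A / 2 * ((lam * W) ^+ 2 / 4))); last first.
      by rewrite ler_pM2l // divr_gt0 // mulr_gt0.
    have DW : D * (eps * A * lam ^+ 2) = 16 * C by rewrite /D divfK // gt_eqF.
    have : 16 * C * W <= W * (eps * A * lam ^+ 2) * W.
      by rewrite ler_pM2r // -DW ler_pM2r //; lra.
    have -> : eps * A / 2 * ((lam * W) ^+ 2 / 4) = W * (eps * A * lam ^+ 2) * W / 8 by field.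
    nra.
  have -> : eps * A / 2 * Z = expR (kappa * W) * (eps * A / 2 * expR (lam * W)) by rewrite Ze; ring.
  apply: (@le_trans _ _ (expR (kappa * W) * (C * (1 + W)))); last by rewrite ler_pM2l ?expR_gt0.
  apply: (@le_trans _ _ (expR (kappa * W) * (2 * A ^+ 2 * (1 + eps) + A + 2 * A * W + 8 + 8 * (W + 1)))).
    rewrite [leRHS]mulrDr; apply: lerD; last by lra.
    have : 0 <= 2 * A ^+ 2 * (1 + eps) + A + 2 * A * W + 8 by nra.
    by move=> h; rewrite ler_peMl.
  have : 0 < A ^+ 2 * (1 + eps) * W by rewrite !mulr_gt0 //; lra.
  have : 0 < A ^+ 2 * (1 + eps) by rewrite mulr_gt0 //; lra.
  rewrite ler_pM2l ?expR_gt0 // /C; nra.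
have G0 := expR_gt0 (kappa * W).
set G := expR _ in main G0 *.
(* The part 2 A v of kappa W u is reserved for the u / Z term of ln tau; the rest, with coefficient
   kappa W - 2 A / Z >= 0, is bounded below at the least admissible u. *)
have lead : 2 * A * v + (1 + eps / 2) * A * Z - 2 * A ^+ 2 * (1 + eps) <= kappa * W * u.
  have cf : 0 <= kappa * W - 2 * A / Z.
    have : 2 * A / Z <= 2 * A by rewrite ler_pdivrMr //; nra.
    nra.
  have := ler_wpM2r cf u0.
  have -> : (1 + eps) * A * Z / W * (kappa * W - 2 * A / Z) =
    kappa * (1 + eps) * A * Z - 2 * A ^+ 2 * (1 + eps) / W.
    by field; rewrite !gt_eqF.
  rewrite ke.
  have -> : u * (kappa * W - 2 * A / Z) = kappa * W * u - 2 * A * v.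
    by rewrite /v; field; rewrite gt_eqF.
  have : 2 * A ^+ 2 * (1 + eps) / W <= 2 * A ^+ 2 * (1 + eps).
    by rewrite ler_pdivrMr // ler_peMr; nra.
  lra.
apply: le_trans lead.
have b1 : A * ln tau <= A * (v + W + Z) by rewrite ler_pM2l.
have b2 : (1 + eta) * (ln 4 + A * ln tau) <= (1 + eta) * (4 + A * (v + W + Z)).
  by rewrite ler_pM2l; lra.
have b3 : 8 * G * (kappa * W + 1) <= 8 * G * (W + 1) by rewrite ler_pM2l; nra.
(* The slack allows no doubling of A Z, so there eta Z <= 1 is used; elsewhere 1 + eta <= 2 is
   enough. *)
have b4 : (1 + eta) * (4 + A * (v + W + Z)) <= 2 * A * v + A * Z + (A + 2 * A * W + 8).
  have -> : (1 + eta) * (4 + A * (v + W + Z)) =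
    (1 + eta) * (4 + A * v + A * W) + A * Z + A * (eta * Z) by ring.
  have : A * (eta * Z) <= A * 1 by rewrite ler_pM2l.
  have Av : 0 < A * v by rewrite mulr_gt0.
  have AW : 0 < A * W by rewrite mulr_gt0.
  have : (1 + eta) * (4 + A * v + A * W) <= 2 * (4 + A * v + A * W).
    by rewrite ler_pM2r; lra.
  lra.
lra.
Qed.

End RealEstimates.

(** * Iterated logarithms and the final assembly *)

Lemma tlogE (R : realType) (x : R) : 2 <= ln x -> tlog x = ln x.
Proof. by move=> h; rewrite /tlog; apply: max_idPl. Qed.

Lemma sum_num_irr_binomials_le (R : realType) (F : finFieldType) (n : nat) :
  (\sum_(1 <= t < n.+1) num_irr_binomials F t)%N%:R <=
  #|F|%:R * \sum_(1 <= t < n.+1) ((\pi(#|F|.-1)).-nat t)%:R :> R.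
Proof.
rewrite natr_sum mulr_sumr; apply: ler_sum_nat => t /andP [t0 _].
by rewrite -natrM ler_nat num_irr_binomials_le.
Qed.

(** With M = 4 (ln T)^A, the term T / M is half of the target; after taking logarithms the
    hypothesis says that Rankin's term is at most T / M too. The 2 in the target will pay for q <= 2
    (q - 1). *)
Lemma smooth_count_saving (R : realType) (N : nat) (A eta T : R) :
  0 < eta <= 2^-1 -> 1 <= ln (N%:R : R) -> 0 < T -> 0 < ln T ->
  (1 + eta) * (ln 4 + A * ln (ln T))
    + 8 * expR (eta * ln (ln N%:R)) * (eta * ln (ln N%:R) + 1) <= eta * ln T ->
  \sum_(1 <= t < (Num.truncn T).+1) ((\pi(N)).-nat t)%:R
  <= T / (2 * ln T `^ A).
Proof.
move=> eh y1 T0 t0 H; set y := ln (N%:R : R) in y1 H *.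
have y0 : 0 < y by exact: lt_le_trans y1.
pose M := 4 * ln T `^ A.
have P0 : 0 < ln T `^ A by rewrite powR_gt0.
have M0 : 0 < M by rewrite mulr_gt0.
have lnM' : ln M = ln 4 + A * ln (ln T) by rewrite /M lnM ?posrE // ln_powR.
apply: le_trans (smooth_count_le eh y1 T0 M0) _.
have -> : T / (2 * ln T `^ A) = T / M + T / M by rewrite /M; field; rewrite gt_eqF.
rewrite lerD2l mulrCA ler_pM2l //.
have -> : y `^ eta = expR (eta * ln y) by rewrite /powR gt_eqF.
rewrite /powR gt_eqF ?divr_gt0 // -expRD -[M^-1]lnK ?posrE ?invr_gt0 // ler_expR.
rewrite lnV ?posrE // ln_div ?posrE // lnM' -/y; lra.
Qed.

(** All the logarithms are at least 2, so the truncation in [tlog] is inactive. Passing from Q to Q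
    - 1 is harmless: Q <= (Q - 1)^2 gives ln (Q - 1) >= S / 2, and U - ln 2 >= U / 2 because U >=
    4. *)
Lemma tlog_iter_chain (R : realType) (W V U S Q : R) :
  2 <= W -> 1 + W <= V -> 1 + V <= U -> 1 + U <= S -> 1 + S <= Q ->
  ln V = W -> ln U = V -> ln S = U -> ln Q = S ->
  [/\ tlog_iter 3 Q = V, tlog_iter 4 Q = W,
    2 <= ln (Q - 1) & U / 2 <= ln (ln (Q - 1)) <= U].
Proof.
have sqr_ge (x : R) : 5 <= x -> x <= (x - 1) ^+ 2 by nra.
move=> W2 WV VU US SQ lV lU lS lQ.
have [V2 U2 S2] : [/\ 2 <= V, 2 <= U & 2 <= S] by split; lra.
have [U0 S0 Q0 Q10] : [/\ 0 < U, 0 < S, 0 < Q & 0 < Q - 1] by split; lra.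
have t1 : tlog Q = S by rewrite tlogE lQ.
have t2 : tlog S = U by rewrite tlogE lS.
have t3 : tlog U = V by rewrite tlogE lU.
have t4 : tlog V = W by rewrite tlogE lV.
have lo : S / 2 <= ln (Q - 1).
  have Q5 : 5 <= Q by lra.
  have : ln Q <= ln ((Q - 1) ^+ 2).
    rewrite ler_ln ?posrE ?exprn_gt0 //; exact: sqr_ge.
  by rewrite lQ lnXn // -[ln _ *+ _]mulr_natl; lra.
have hi : ln (Q - 1) <= S by rewrite -lQ ler_ln ?posrE // gerBl.
have y0 : 0 < ln (Q - 1) by apply: lt_le_trans lo; rewrite divr_gt0.
have lo2 : ln (S / 2) <= ln (ln (Q - 1)) by rewrite ler_ln ?posrE ?divr_gt0.
have hi2 : ln (ln (Q - 1)) <= U by rewrite -lS ler_ln ?posrE.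
have ln2 : ln (2 : R) < 2 by exact: ln_sublinear.
move: lo2; rewrite ln_div ?posrE // lS => lo2.
split; rewrite /tlog_iter /= ?t1 ?t2 ?t3 ?t4 //; first lra.
by rewrite hi2 andbT; lra.
Qed.

Lemma tlog_iter_expR4 (R : realType) (W0 Q : R) :
  2 <= W0 -> expR (expR (expR (expR W0))) <= Q ->
  exists W, [/\ W0 <= W, tlog_iter 3 Q = expR W, tlog_iter 4 Q = W,
    2 <= ln (Q - 1) & expR (expR W) / 2 <= ln (ln (Q - 1)) <= expR (expR W)].
Proof.
move=> W02.
have ex_exp (a b : R) : expR a <= b -> exists2 c, b = expR c & a <= c.
  move=> h; have b0 : 0 < b by exact: lt_le_trans (expR_gt0 a) h.
  by exists (ln b); rewrite ?lnK // -ler_expR lnK.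
move=> /ex_exp [S -> /ex_exp [U -> /ex_exp [V -> /ex_exp [W -> hW]]]].
exists W; have W2 := le_trans W02 hW.
have [-> -> ? ?] := tlog_iter_chain W2 (expR_ge1Dx _) (expR_ge1Dx _) (expR_ge1Dx _)
  (expR_ge1Dx _) (expRK _) (expRK _) (expRK _) (expRK _).
by split.
Qed.

Theorem theorem1p3 (R : realType) (A eps : R) (hA : 0 < A) (heps : 0 < eps) :
  exists (q0 : nat) (T0 : R),
    forall (q : nat) (F : finFieldType) (T : R),
      prime_power q -> #|F| = q -> (q0 <= q)%N -> T0 <= T ->
      tlog (q%:R - 1 : R) `^
        ((1 + eps) * A * tlog_iter 3 (q%:R : R) / tlog_iter 4 (q%:R : R)) <= T ->
      (\sum_(1 <= t < (Num.truncn T).+1) num_irr_binomials F t)%N%:R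
        <= (q%:R - 1) * T / (tlog T `^ A).
Proof.
have [W0 [W02 saving]] := rankin_saving hA heps.
(* The first threshold ensures ln ln ln ln q >= W0; the second gives ln T >= 2, so that [tlog T] is
   ln T. *)
exists (Num.truncn (expR (expR (expR (expR W0))))).+1, (expR 2).
move=> q F T _ Fq hq hT.
have hQ : expR (expR (expR (expR W0))) <= q%:R :> R.
  apply: ltW; apply: lt_le_trans (_ : (Num.truncn (expR (expR (expR (expR W0))))).+1%:R <= _).
    by have /andP [] := truncn_itv (expR_ge0 (expR (expR (expR W0)))).
  by rewrite ler_nat.
have q0 : (0 < q)%N by exact: leq_ltn_trans hq.
have qN : q.-1%:R = q%:R - 1 :> R by rewrite -[in RHS](prednK q0) -natr1 addrK.
have [W [hW -> -> y2 hX]] := tlog_iter_expR4 W02 hQ.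
have T0 : 0 < T by exact: lt_le_trans (expR_gt0 _) hT.
have t2 : 2 <= ln T by rewrite -(expRK 2) ler_ln ?posrE ?expR_gt0.
have t0 : 0 < ln T by exact: lt_le_trans t2.
have P0 : 0 < ln T `^ A by rewrite powR_gt0.
have y1 : 1 <= ln (q%:R - 1 : R) by apply: le_trans y2; rewrite ler1n.
have y0 : 0 < ln (q%:R - 1 : R) by exact: lt_le_trans y1.
rewrite !tlogE // => hyp.
have {}hyp : (1 + eps) * A * expR W / W * ln (ln (q%:R - 1)) <= ln T.
  by rewrite -ln_powR ler_ln ?posrE ?powR_gt0.
have [eta [eh H]] := saving _ _ _ hW hX hyp.
apply: le_trans (sum_num_irr_binomials_le _ _ _) _; rewrite Fq.
have q1 : 0 < q.-1%:R :> R.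
  by rewrite qN; apply: contraTT y0; rewrite -!leNgt => h; rewrite ln0.
rewrite -qN in y1 H *.
apply: (@le_trans _ _ (q%:R * (T / (2 * ln T `^ A)))).
  by rewrite ler_wpM2l //; exact: smooth_count_saving eh y1 T0 t0 H.
have -> : q%:R * (T / (2 * ln T `^ A)) = q%:R / 2 * (T / ln T `^ A).
  by field; rewrite gt_eqF.
rewrite -[leRHS]mulrA ler_pM2r ?divr_gt0 // ler_pdivrMr // -natrM ler_nat.
rewrite ltr0n in q1.
by rewrite muln2 -addnn -[leqLHS](prednK q0) -[leqLHS]addn1 leq_add2l.
Qed.
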